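(* As formal Laurent series in $q$, coefficientwise, $$\frac{1}{q}\frac{(-q;q^2)_{\infty}}{(q^3;q^2)_{\infty}}\sum_{n=0}^{\infty}\frac{(q;q^2)_n(-q)^n}{(-q;q^2)_{n}(1+q^{2n})}p_{2n}(-1;q^{-2n-1},-1:q)\equiv\frac{1}{2q}-\frac{1}{2}\pmod{4}.$$
   Context: $(a;q)_n=\prod_{j=0}^{n-1}(1-aq^j)$, $(a;q)_\infty=\prod_{j\ge0}(1-aq^j)$. The little $q$-Jacobi polynomial is $p_n(x;a,b:q)=\sum_{k\ge0}\frac{(q^{-n};q)_k(abq^{n+1};q)_k}{(q;q)_k(aq;q)_k}(qx)^k$; in particular $p_{2n}(-1;q^{-2n-1},-1:q)=\sum_{p=0}^{2n}\frac{(-1;q)_p(-q)^p}{(q;q)_p}$. *)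

(* Defs.v *)
From mathcomp Require Import all_boot all_order all_algebra.
Set Implicit Arguments. Unset Strict Implicit. Unset Printing Implicit Defensive.
Import Order.TTheory GRing.Theory Num.Theory.
Local Open Scope ring_scope.

Definition fps := nat -> rat.

Definition fps_const (c : rat) : fps := fun n => if n == 0%N then c else 0.
Definition fps_mono (c : rat) (k : nat) : fps := fun n => if n == k then c else 0.
Definition fps_add (f g : fps) : fps := fun n => f n + g n.
Definition fps_mul (f g : fps) : fps := fun n => \sum_(i < n.+1) f i * g (n - i)%N.

(** Multiplicative inverse of a series with nonzero constant term:
    inv_aux f n = [:: g_0; ...; g_n] with g_0 = 1/f_0 and
    g_n = -(1/f_0) * sum_{j=1}^n f_j g_{n-j}. *)
Fixpoint fps_inv_aux (f : fps) (n : nat) : seq rat :=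
  match n with
  | 0 => [:: (f 0%N)^-1]
  | m.+1 => let s := fps_inv_aux f m in
            rcons s (- (f 0%N)^-1 * \sum_(i < m.+1) f i.+1 * nth 0 s (m - i)%N)
  end.
Definition fps_inv (f : fps) : fps := fun n => nth 0 (fps_inv_aux f n) n.

Fixpoint fps_prodn (n : nat) (F : nat -> fps) : fps :=
  match n with 0 => fps_const 1 | m.+1 => fps_mul (fps_prodn m F) (F m) end.
Fixpoint fps_sumn (n : nat) (F : nat -> fps) : fps :=
  match n with 0 => fps_const 0 | m.+1 => fps_add (fps_sumn m F) (F m) end.

Definition qpoch (c : rat) (a b n : nat) : fps :=
  fps_prodn n (fun j => fps_add (fps_const 1) (fps_mono (- c) (a + b * j)%N)).

(** p_{2n}(-1; q^{-2n-1}, -1 : q) = sum_{p=0}^{2n} (-1;q)_p (-q)^p / (q;q)_p *)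
Definition p2n (n : nat) : fps :=
  fps_sumn (2 * n).+1 (fun p =>
    fps_mul (fps_mul (qpoch (-1) 0 1 p) (fps_mono ((-1) ^+ p) p))
            (fps_inv (qpoch 1 1 1 p))).

Definition summand (n : nat) : fps :=
  fps_mul
    (fps_mul (fps_mul (qpoch 1 1 2 n) (fps_mono ((-1) ^+ n) n))
             (fps_inv (fps_mul (qpoch (-1) 1 2 n)
                               (fps_add (fps_const 1) (fps_mono 1 (2 * n))))))
    (p2n n).

(** N-th approximant of (-q;q^2)_oo/(q^3;q^2)_oo * sum_n summand n
    (infinite products and the sum truncated at N). *)
Definition approx (N : nat) : fps :=
  fps_mul (fps_mul (qpoch (-1) 1 2 N) (fps_inv (qpoch 1 3 2 N)))
          (fps_sumn N summand).

Definition shift_inv_q (G : fps) (k : int) : rat :=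
  match k with
  | Posz n => G n.+1
  | Negz 0 => G 0%N
  | Negz _ => 0
  end.

Definition rhs_coeff (k : int) : rat :=
  if k == -1 then 1 / 2 else if k == 0 then - (1 / 2) else 0.

(* Main.v *)
(* Let R = (-q;q^2)_oo / (q;q^2)_oo, let t_n be the n-th weight
   (q;q^2)_n (-q)^n / ((-q;q^2)_n (1 + q^{2n})), and let S be the sum of
   t_n p_{2n} over n >= 1.  The term n = 0 is 1/2, so the series is
   (1 - q) R (1 + 2 S) / 2 and the claim is R (1 + 2 S) = 1 mod 8.

   Put w_p = q^p / (1 - q^p), v_j = q^{2j+1} / (1 + q^{2j+1}).  Modulo 4,
   (q;q^2)_n / (-q;q^2)_n = 1 - 2 sum_{j<n} v_j and
   p_{2n} = 1 + 2 sum_{p<=2n} w_p; the odd p cancel against the v_j, whence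
     t_n p_{2n} = (-q)^n / (1 + q^{2n})
                  + 2 q^n / (1 + q^{2n}) sum_{1<=j<=n} w_{2j}   mod 4.
   On the other side 1/R = prod (1 - 2 v_j) = 1 - 2 e_1 + 4 e_2 mod 8, with e_i
   the elementary symmetric functions of the v_j, so S = - e_1 + 2 e_2 mod 4 is
   wanted.  Interchanging summations, e_1 = - sum (-q)^n / (1 - q^{2n}), so
   that e_1 + sum (-q)^n / (1 + q^{2n}) cancels the terms j = n; the terms
   j < n match e_2 through q^{n k + 2 j l} = q^{(n - j) k + j (k + 2 l)}.

   Coefficients up to q^d are computed in Z[q]/(q^{d+1}), where q is nilpotent
   and all sums and products are finite. *)
Require Import Defs.
From mathcomp Require Import all_boot all_order all_algebra.
From mathcomp Require Import zify ring lra.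
Set Implicit Arguments. Unset Strict Implicit. Unset Printing Implicit Defensive.
Import Order.TTheory GRing.Theory Num.Theory.
Local Open Scope ring_scope.

(** * Congruences in a commutative ring, and a rearrangement of triangular sums *)

Section Congruence.
Variable A : comNzRingType.
Implicit Types (m : nat) (a b c x y : A).

Definition cgr m a b := exists c, a = b + m%:R * c.

Lemma cgr_refl m a : cgr m a a.
Proof. by exists 0; rewrite mulr0 addr0. Qed.

Lemma cgr_sym m a b : cgr m a b -> cgr m b a.
Proof. by move=> [c ->]; exists (- c); rewrite mulrN addrK. Qed.

Lemma cgr_trans m b a c : cgr m a b -> cgr m b c -> cgr m a c.
Proof. by move=> [x ->] [y ->]; exists (y + x); rewrite mulrDr addrA. Qed.

Lemma cgrD m a b x y : cgr m a b -> cgr m x y -> cgr m (a + x) (b + y).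
Proof. by move=> [c ->] [d ->]; exists (c + d); ring. Qed.

Lemma cgrM m a b x y : cgr m a b -> cgr m x y -> cgr m (a * x) (b * y).
Proof.
by move=> [c ->] [d ->]; exists (c * y + b * d + m%:R * c * d); ring.
Qed.

Lemma cgr_sum m (I : Type) (r : seq I) (P : pred I) (F G : I -> A) :
  (forall i, P i -> cgr m (F i) (G i)) ->
  cgr m (\sum_(i <- r | P i) F i) (\sum_(i <- r | P i) G i).
Proof.
move=> FG; apply: (big_ind2 (cgr m)) => //; first exact: cgr_refl.
exact: cgrD.
Qed.

Lemma cgr_prod m (I : Type) (r : seq I) (P : pred I) (F G : I -> A) :
  (forall i, P i -> cgr m (F i) (G i)) ->
  cgr m (\prod_(i <- r | P i) F i) (\prod_(i <- r | P i) G i).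
Proof.
move=> FG; apply: (big_ind2 (cgr m)) => //; first exact: cgr_refl.
exact: cgrM.
Qed.

Lemma cgr_scale (k m : nat) a b :
  cgr m a b -> cgr (k * m) (k%:R * a) (k%:R * b).
Proof. by move=> [c ->]; exists c; rewrite natrM; ring. Qed.

Lemma cgr_sign (k : nat) a : cgr 2 ((-1) ^+ k * a) a.
Proof.
rewrite -signr_odd; case: (odd k); first by exists (- a); ring.
by rewrite mul1r; exact: cgr_refl.
Qed.

Lemma prod_1sub2_cgr4 (v : nat -> A) n :
  cgr 4 (\prod_(j < n) (1 - 2 * v j)) (1 - 2 * \sum_(j < n) v j).
Proof.
elim: n => [|n [c IHn]]; first by rewrite !big_ord0 mulr0 subr0; exact: cgr_refl.
rewrite !big_ord_recr /= IHn.
by exists (v n * (\sum_(j < n) v j) + c * (1 - 2 * v n)); ring.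
Qed.

(** In the expanded product the terms of degree [i] in [v] carry [2 ^ i], so those of degree 3 and
    more vanish modulo 8; the double sum is e_2. *)
Lemma prod_1sub2_cgr8 (v : nat -> A) n :
  cgr 8 (\prod_(j < n) (1 - 2 * v j))
        (1 - 2 * (\sum_(j < n) v j)
           + 4 * \sum_(j < n) v j * \sum_(i < j) v i).
Proof.
elim: n => [|n [c IHn]].
  by rewrite !big_ord0; exists 0; ring.
rewrite !big_ord_recr /= IHn.
set e1 := \sum_(j < n) v j; set e2 := \sum_(j < n) _.
by exists (c * (1 - 2 * v n) - v n * e2); ring.
Qed.

(** Substitute [n = j + m + 1]. The square on the right also contains pairs with [j + m + 1 >= D],
    where [F] vanishes. *)
Lemma triangular_sum (D : nat) (F : nat -> nat -> A) :
  (forall n j, (D <= n)%N -> F n j = 0) ->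
  \sum_(n < D) \sum_(j < n) F n j =
  \sum_(j < D) \sum_(m < D) F (j + m).+1 j.
Proof.
move=> F0.
transitivity (\sum_(0 <= n < D) \sum_(0 <= j < D | (j < n)%N) F n j).
  rewrite big_mkord; apply: eq_bigr => n _; rewrite -(big_mkord predT (F n)).
  by rewrite (big_nat_widen 0 n D) // ltnW.
rewrite (exchange_big_dep_nat predT) //= big_mkord; apply: eq_bigr => j _.
rewrite -(big_mkord predT (fun m => F (j + m).+1 j)).
rewrite -(big_nat_widenl j.+1 0 D xpredT (F^~ j)) //.
have -> : \sum_(j.+1 <= n < D) F n j = \sum_(j.+1 <= n < j.+1 + D) F n j.
  rewrite (@big_cat_nat _ _ _ D j.+1 (j.+1 + D)) /=; first last.
  - by rewrite leq_addl.
  - exact: ltn_ord.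
  rewrite [X in _ + X]big1_seq ?addr0 // => n /andP[_].
  by rewrite mem_index_iota => /andP[/F0 -> ].
rewrite -{1}[j.+1]add0n big_addn addKn.
by apply: eq_bigr => m _; rewrite addnS addnC.
Qed.

End Congruence.

(** * The congruence modulo 8, with nilpotent [q] *)

Section Nilpotent.
Variables (A : comNzRingType) (q : A) (D : nat).
Hypothesis qD : q ^+ D = 0.

(* As [q] is nilpotent, [gm e] is [1 / (1 - q ^+ e)] and [gp e] is
   [1 / (1 + q ^+ e)] for [0 < e]. *)
Definition geom (x : A) := \sum_(i < D) x ^+ i.
Definition gm e := geom (q ^+ e).
Definition gp e := geom (- q ^+ e).

Lemma qpow0 n : (D <= n)%N -> q ^+ n = 0.
Proof. by move=> Dn; rewrite -(subnK Dn) exprD qD mulr0. Qed.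

Lemma geomK x : x ^+ D = 0 -> (1 - x) * geom x = 1.
Proof. by move=> xD; rewrite -opprB mulNr -subrX1 xD sub0r opprK. Qed.

Lemma gmK e : (0 < e)%N -> (1 - q ^+ e) * gm e = 1.
Proof. by move=> e0; rewrite geomK // -exprM qpow0 // leq_pmull. Qed.

Lemma gpK e : (0 < e)%N -> (1 + q ^+ e) * gp e = 1.
Proof.
move=> e0; rewrite -[X in 1 + X]opprK geomK // exprNn -exprM.
by rewrite qpow0 ?mulr0 // leq_pmull.
Qed.

Lemma gpBgm e : (0 < e)%N -> gp e = gm e - 2 * (q ^+ e * gm e * gp e).
Proof.
move=> e0.
(* The difference is a combination of the two inverse identities [gmK] and [gpK]. *)
apply/subr0_eq; have -> : gp e - (gm e - 2 * (q ^+ e * gm e * gp e)) =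
  gp e * (1 - (1 - q ^+ e) * gm e) - gm e * (1 - (1 + q ^+ e) * gp e) by ring.
by rewrite gmK // gpK // subrr !mulr0 subrr.
Qed.

Lemma gp_cgr2 e : (0 < e)%N -> cgr 2 (gp e) (gm e).
Proof.
by move=> e0; exists (- (q ^+ e * gm e * gp e)); rewrite [LHS]gpBgm //; ring.
Qed.

Lemma oneBgp e : (0 < e)%N -> (1 - q ^+ e) * gp e = 1 - 2 * (q ^+ e * gp e).
Proof. by move=> e0; rewrite -[X in _ = X - _](gpK e0); ring. Qed.

Lemma oneDgm e : (0 < e)%N -> (1 + q ^+ e) * gm e = 1 + 2 * (q ^+ e * gm e).
Proof. by move=> e0; rewrite -[X in _ = X + _](gmK e0); ring. Qed.

(* [rho n] is (q;q^2)_n / (-q;q^2)_n, and [jacobi n] is p_{2n}. *)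
Definition rho n : A :=
  (\prod_(j < n) (1 - q ^+ (2 * j).+1)) * \prod_(j < n) gp (2 * j).+1.
Definition weight n : A := rho n * ((-1) ^+ n * q ^+ n) * gp (2 * n).
Definition jacobi n : A :=
  \sum_(p < (2 * n).+1) (\prod_(j < p) (1 + q ^+ j)) * ((-1) ^+ p * q ^+ p) *
     \prod_(j < p) gm j.+1.
Definition vodd j := q ^+ (2 * j).+1 * gp (2 * j).+1.
Definition wgm e := q ^+ e * gm e.

Lemma rhoE n : rho n = \prod_(j < n) (1 - 2 * vodd j).
Proof. by rewrite /rho -big_split /=; apply: eq_bigr => j _; rewrite oneBgp. Qed.

(** For [p > 0] the factor [j = 0] of (-1;q)_p is 2, so the rest of the term matters only modulo 2.
    There each (1 + q^i) / (1 - q^i) is 1, which leaves the last denominator 1 - q^p. *)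
Lemma jacobi_cgr n : cgr 4 (jacobi n) (1 + 2 * \sum_(p < 2 * n) wgm p.+1).
Proof.
rewrite /jacobi big_ord_recl !big_ord0 expr0 !mul1r /=.
apply: cgrD; first exact: cgr_refl.
rewrite mulr_sumr; apply: cgr_sum => p _; rewrite /bump /= add1n.
rewrite big_ord_recl /= [X in _ * _ * X]big_ord_recr /= expr0.
set a := \prod_(i < p) _; set b := \prod_(i < p) _.
have abE : a * b = \prod_(i < p) ((1 + q ^+ i.+1) * gm i.+1).
  by rewrite -big_split.
have : cgr 2 (a * b) (\prod_(i < p) 1).
  rewrite abE; apply: cgr_prod => i _.
  by rewrite oneDgm //; exists (wgm i.+1).
rewrite big1_eq => ab1.
have -> : (1 + 1) * a * ((-1) ^+ p.+1 * q ^+ p.+1) * (b * gm p.+1) =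
  2 * ((-1) ^+ p.+1 * (a * b * wgm p.+1)) by rewrite /wgm; ring.
apply: (@cgr_scale A 2 2); apply: cgr_trans (cgr_sign _ _) _.
by rewrite -[X in cgr 2 _ X]mul1r; apply: cgrM => //; exact: cgr_refl.
Qed.

Lemma sum_parity (F : nat -> A) n :
  \sum_(p < 2 * n) F p = \sum_(j < n) F (2 * j)%N + \sum_(j < n) F (2 * j).+1.
Proof.
elim: n => [|n IHn]; first by rewrite !big_ord0 addr0.
by rewrite mulnS !big_ord_recr /= IHn; ring.
Qed.

(* The odd [p] of [jacobi] cancel modulo 2 against the sum coming from [rho]. *)
Lemma term_cgr n :
  cgr 4 (weight n.+1 * jacobi n.+1)
    ((-1) ^+ n.+1 * q ^+ n.+1 * gp (2 * n.+1)
      + 2 * (q ^+ n.+1 * gp (2 * n.+1) * \sum_(j < n.+1) wgm (2 * j.+1))).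
Proof.
set m := n.+1; set E := \sum_(j < m) _.
set s := (-1) ^+ m * q ^+ m * gp (2 * m).
have [x Hrho] := prod_1sub2_cgr4 vodd m.
have [y HJ] := jacobi_cgr m.
have [z HV] : cgr 2 (\sum_(j < m) vodd j) (\sum_(j < m) wgm (2 * j).+1).
  apply: cgr_sum => j _; apply: cgrM; first exact: cgr_refl.
  exact: gp_cgr2.
have [t Hs] : cgr 2 (s * E) (q ^+ m * gp (2 * m) * E).
  by rewrite /s -!mulrA; exact: cgr_sign.
have HE : \sum_(p < 2 * m) wgm p.+1 = \sum_(j < m) wgm (2 * j).+1 + E.
  by rewrite (sum_parity (fun p => wgm p.+1)); congr (_ + _);
     apply: eq_bigr => j _; rewrite mulnS.
rewrite /weight rhoE Hrho HJ HE HV.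
set W := \sum_(j < m) wgm (2 * j).+1.
have -> : 2 * (q ^+ m * gp (2 * m) * E) = 2 * (s * E) - 4 * t by rewrite Hs; ring.
(* In the expanded product [- 2 * W] meets [2 * (W + E)], leaving [s + 2 * (s * E)]. The witness
   collects the multiples of 4; [t] accounts for the sign dropped from [s]. *)
exists (s * (- z - (W + 2%:R * z) * (W + E) + x + 2 * x * (W + E) + y
   - 2 * (W + 2 * z) * y + 4 * x * y) + t).
by rewrite /s; ring.
Qed.

(** Expand each [vodd j] as a geometric series and sum over [j] first:
    [(2j+1)(n+1) = (n+1) + 2(n+1)j]. *)
Lemma sum_vodd :
  \sum_(j < D) vodd j =
  - \sum_(n < D) (-1) ^+ n.+1 * q ^+ n.+1 * gm (2 * n.+1).
Proof.
rewrite -sumrN.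
under eq_bigr => j _ do rewrite /vodd /gp /geom mulr_sumr.
rewrite exchange_big /=; apply: eq_bigr => n _.
rewrite /gm /geom mulr_sumr -sumrN; apply: eq_bigr => j _.
rewrite (exprNn _ n) -!exprM (exprS (-1)) !mulN1r !mulNr opprK.
rewrite mulrCA -mulrA -!exprD; congr (_ * _ ^+ _); lia.
Qed.

(** Replacing [gp] by [gm] in the first sum costs [2 * (-1) ^+ m * z], which cancels the diagonal
    term [2 * z] modulo 4; [sum_vodd] evaluates what is left. *)
Lemma weights_diag_cgr :
  cgr 4 (\sum_(n < D) (-1) ^+ n.+1 * q ^+ n.+1 * gp (2 * n.+1)
         + 2 * \sum_(n < D) q ^+ n.+1 * gp (2 * n.+1) * wgm (2 * n.+1))
        (- \sum_(j < D) vodd j).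
Proof.
rewrite sum_vodd opprK mulr_sumr -big_split /=.
apply: cgr_sum => n _; set m := n.+1; set e := (2 * m)%N.
set z := q ^+ m * gp e * wgm e.
have [c Hc] := cgr_sign m z.
exists (- c); rewrite [X in _ * X + _]gpBgm //.
have -> : (-1) ^+ m * q ^+ m * (gm e - 2 * (q ^+ e * gm e * gp e)) =
  (-1) ^+ m * q ^+ m * gm e - 2 * ((-1) ^+ m * z) by rewrite /z /wgm; ring.
by rewrite Hc; ring.
Qed.

(* Both sides enumerate [q ^+ (n (2 k + 1) + 2 j (l + 1))] over [j < n]: write
   [n = j + m], then [k + l + 1] for the larger of the two odd factors. *)
Lemma off_diag :
  \sum_(n < D) \sum_(j < n) q ^+ n.+1 * gm (2 * n.+1) * wgm (2 * j.+1) =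
  \sum_(l < D) \sum_(k < l) wgm (2 * l).+1 * wgm (2 * k).+1.
Proof.
pose T n j k l := q ^+ (n.+1 * (2 * k).+1 + 2 * j.+1 * l.+1).
pose U j m k l := q ^+ (j.+1 * (2 * l).+1 + m.+1 * (2 * k).+1).
have lhsE n j : q ^+ n.+1 * gm (2 * n.+1) * wgm (2 * j.+1) =
    \sum_(k < D) \sum_(l < D) T n j k l.
  rewrite /wgm /gm /geom [q ^+ n.+1 * _]mulr_sumr [q ^+ (2 * j.+1) * _]mulr_sumr.
  rewrite big_distrlr /=; apply: eq_bigr => k _; apply: eq_bigr => l _.
  by rewrite -!exprM -!exprD /T; congr (_ ^+ _); lia.
have rhsE l k : wgm (2 * l).+1 * wgm (2 * k).+1 =
    \sum_(j < D) \sum_(m < D) U j m k l.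
  rewrite /wgm /gm /geom [q ^+ (2 * l).+1 * _]mulr_sumr.
  rewrite [q ^+ (2 * k).+1 * _]mulr_sumr.
  rewrite big_distrlr /=; apply: eq_bigr => j _; apply: eq_bigr => m _.
  by rewrite -!exprM -!exprD /U; congr (_ ^+ _); lia.
under eq_bigr => n _ do under eq_bigr => j _ do rewrite lhsE.
under [RHS]eq_bigr => l _ do under eq_bigr => k _ do rewrite rhsE.
rewrite (triangular_sum (F := fun n j => \sum_(k < D) \sum_(l < D) T n j k l)).
  rewrite (triangular_sum
    (F := fun l k => \sum_(j < D) \sum_(m < D) U j m k l)).
    (* All four indices now run below [D] independently, so reordering suffices to match the
       terms. *)
    transitivity (\sum_(j < D) \sum_(k < D) \sum_(m < D) \sum_(l < D)
                   T (j + m).+1 j k l).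
      by apply: eq_bigr => j _; rewrite exchange_big.
    rewrite exchange_big /=; apply: eq_bigr => k _.
    transitivity (\sum_(j < D) \sum_(l < D) \sum_(m < D) T (j + m).+1 j k l).
      by apply: eq_bigr => j _; rewrite exchange_big.
    rewrite exchange_big /=; apply: eq_bigr => l _.
    apply: eq_bigr => j _; apply: eq_bigr => m _.
    by rewrite /T /U; congr (_ ^+ _); lia.
  (* An index of at least [D] forces an exponent of at least [D]. *)
  move=> l k Dl; rewrite big1 // => j _; rewrite big1 // => m _.
  by apply: qpow0; nia.
move=> n j Dn; rewrite big1 // => k _; rewrite big1 // => l _.
by apply: qpow0; nia.
Qed.

Lemma weighted_sum_cgr :
  cgr 4 (\sum_(n < D) weight n.+1 * jacobi n.+1)
        (- (\sum_(j < D) vodd j)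
         + 2 * \sum_(j < D) vodd j * \sum_(i < j) vodd i).
Proof.
apply: cgr_trans.
  by apply: cgr_sum => n _; exact: term_cgr.
rewrite big_split /= -mulr_sumr.
under [X in _ + 2 * X]eq_bigr => n _ do rewrite big_ord_recr /= mulrDr.
rewrite big_split /= [X in _ + 2 * X]addrC mulrDr addrA.
apply: cgrD; first exact: weights_diag_cgr.
(* The terms [j < n] carry a factor 2, so they are compared modulo 2, where [gp] and [gm] agree. *)
apply: (@cgr_scale A 2 2).
apply: cgr_trans (_ : cgr 2 _ (\sum_(n < D) \sum_(j < n)
   q ^+ n.+1 * gm (2 * n.+1) * wgm (2 * j.+1))) _.
  apply: cgr_sum => n _; rewrite mulr_sumr; apply: cgr_sum => j _.
  apply: cgrM; last exact: cgr_refl.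
  by apply: cgrM; [exact: cgr_refl | exact: gp_cgr2].
rewrite off_diag; apply: cgr_sym.
apply: cgr_sum => l _; rewrite mulr_sumr; apply: cgr_sum => k _.
by apply: cgrM; (apply: cgrM; [exact: cgr_refl | exact: gp_cgr2]).
Qed.

(* (-q;q^2)_n / (q;q^2)_n *)
Definition theta_quot n : A :=
  (\prod_(j < n) (1 + q ^+ (2 * j).+1)) * \prod_(j < n) gm (2 * j).+1.

Lemma theta_quotK n : theta_quot n * rho n = 1.
Proof.
rewrite /theta_quot /rho -!big_split /= big1 // => j _.
by rewrite mulrACA [gm _ * _]mulrC mulrACA gpK // gmK // mulr1.
Qed.

(** As [theta_quot D] is inverse to [rho D], the second factor need only agree with [rho D] modulo
    8; this is [weighted_sum_cgr] doubled. *)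
Lemma theta_quot_sum_cgr8 :
  cgr 8 (theta_quot D * (1 + 2 * \sum_(n < D) weight n.+1 * jacobi n.+1)) 1.
Proof.
rewrite -[X in cgr 8 _ X](theta_quotK D).
apply: cgrM; first exact: cgr_refl.
rewrite rhoE; apply: cgr_sym; apply: cgr_trans (prod_1sub2_cgr8 _ _) _.
apply: cgr_sym; rewrite -addrA; apply: cgrD; first exact: cgr_refl.
have := cgr_scale 2 weighted_sum_cgr.
by rewrite mulrDr mulrN mulrA -natrM.
Qed.

End Nilpotent.

(** * Recursion for inverse series, and stability of truncated sums and products *)

Lemma size_fps_inv_aux f n : size (fps_inv_aux f n) = n.+1.
Proof. by elim: n => //= n IHn; rewrite size_rcons IHn. Qed.

Lemma nth_fps_inv_aux f n k :
  (k <= n)%N -> nth 0 (fps_inv_aux f n) k = fps_inv f k.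
Proof.
elim: n => [|n IHn]; first by rewrite leqn0 => /eqP ->.
rewrite leq_eqVlt => /orP[/eqP -> // | kn].
by rewrite /= nth_rcons size_fps_inv_aux kn IHn.
Qed.

Lemma fps_invS f n : fps_inv f n.+1 =
  - (f 0%N)^-1 * \sum_(i < n.+1) f i.+1 * fps_inv f (n - i)%N.
Proof.
rewrite {1}/fps_inv /= nth_rcons size_fps_inv_aux ltnn eqxx; congr (_ * _).
by apply: eq_bigr => i _; rewrite nth_fps_inv_aux // leq_subr.
Qed.

Lemma big_ord_stable (R : Type) (idx : R) (op : Monoid.law idx) (F : nat -> R)
    (D N : nat) : (D <= N)%N -> (forall j, (D <= j)%N -> F j = idx) ->
  \big[op/idx]_(j < N) F j = \big[op/idx]_(j < D) F j.
Proof.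
move=> DN F1; rewrite -!(big_mkord predT) (big_cat_nat (leq0n D) DN) /=.
rewrite [X in op _ X]big1_seq ?Monoid.mulm1 // => j /andP[_].
by rewrite mem_index_iota => /andP[/F1].
Qed.

(** * Transfer from the truncated ring to rational power series *)

Section Truncation.
Variable d : nat.

(** Coefficients are integers because over the rationals any two elements are congruent modulo 8. *)
Definition tring : comNzRingType := {poly %/ ('X^(d.+1) : {poly int})}.
Definition tcoef (a : tring) i : int := (a : {poly int})`_i.
Definition trunc (p : {poly int}) : tring := in_qpoly 'X^(d.+1) p.
Definition tX : tring := trunc 'X.

Lemma tcoef_trunc p i : (i <= d)%N -> tcoef (trunc p) i = p`_i.
Proof.
move=> id; rewrite /tcoef /trunc /= mk_monic_Xn.
by rewrite -Pdiv.RingMonic.take_poly_rmodp coef_take_poly ltnS id.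
Qed.

Lemma tcoefM a b i : (i <= d)%N ->
  tcoef (a * b) i = \sum_(j < i.+1) tcoef a j * tcoef b (i - j).
Proof.
by move=> id; rewrite -coefM -[RHS]tcoef_trunc.
Qed.

Lemma tcoefD a b i : tcoef (a + b) i = tcoef a i + tcoef b i.
Proof. exact: coefD. Qed.

Lemma tcoefMn a n i : tcoef (a *+ n) i = tcoef a i *+ n.
Proof.
elim: n => [|n IHn]; first exact: coef0.
by rewrite !mulrS tcoefD IHn.
Qed.

Lemma tcoef_monom (z : int) k i :
  (i <= d)%N -> tcoef (z%:~R * tX ^+ k) i = if i == k then z else 0.
Proof.
move=> id; have -> : z%:~R * tX ^+ k = trunc (z%:~R * 'X^k).
  by rewrite /trunc rmorphM rmorph_int rmorphXn.
rewrite tcoef_trunc // -(rmorph_int polyC) coefCM coefXn intz.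
by case: eqP => _; rewrite ?mulr1 ?mulr0.
Qed.

Lemma tX_nilp : tX ^+ d.+1 = 0.
Proof.
rewrite -(rmorphXn (in_qpoly 'X^(d.+1))) /=; apply: val_inj => /=.
by rewrite mk_monic_Xn Pdiv.RingMonic.rmodpp ?monicXn.
Qed.

(* The factor [c] absorbs the denominator of the term [n = 0] of the sum, whose
   value is 1/2. *)
Definition rep (c : rat) (f : fps) (a : tring) :=
  forall i, (i <= d)%N -> c * f i = (tcoef a i)%:~R.

Lemma rep_mul c1 c2 f g a b :
  rep c1 f a -> rep c2 g b -> rep (c1 * c2) (fps_mul f g) (a * b).
Proof.
move=> fa gb i id; rewrite tcoefM // rmorph_sum mulr_sumr; apply: eq_bigr => j _.
rewrite rmorphM /= -fa; last by rewrite (leq_trans _ id) // -ltnS.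
by rewrite -gb ?(leq_trans (leq_subr _ _)) //; ring.
Qed.

Lemma rep_add c f g a b : rep c f a -> rep c g b -> rep c (fps_add f g) (a + b).
Proof. by move=> fa gb i id; rewrite tcoefD rmorphD /= mulrDr fa ?gb. Qed.

Lemma rep_mono (z : int) (c : rat) k :
  c = z%:~R -> rep 1 (fps_mono c k) (z%:~R * tX ^+ k).
Proof.
by move=> -> i id; rewrite tcoef_monom // /fps_mono mul1r; case: eqP.
Qed.

Lemma rep_const1 : rep 1 (fps_const 1) 1.
Proof.
by move=> i id; rewrite /tcoef coef1 mul1r /fps_const; case: eqP.
Qed.

Lemma rep_const0 c : rep c (fps_const 0) 0.
Proof.
by move=> i id; rewrite /tcoef coef0 /fps_const; case: eqP; rewrite mulr0.
Qed.

Lemma rep_prodn (F : nat -> fps) a n :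
  (forall j, rep 1 (F j) (a j)) -> rep 1 (fps_prodn n F) (\prod_(j < n) a j).
Proof.
move=> Fa; elim: n => [|n IHn]; first by rewrite big_ord0; exact: rep_const1.
by rewrite big_ord_recr -[X in rep X]mulr1; exact: rep_mul.
Qed.

Lemma rep_sumn c (F : nat -> fps) a n :
  (forall j, rep c (F j) (a j)) -> rep c (fps_sumn n F) (\sum_(j < n) a j).
Proof.
move=> Fa; elim: n => [|n IHn]; first by rewrite big_ord0; exact: rep_const0.
by rewrite big_ord_recr; exact: rep_add.
Qed.

(** The coefficients of [b] satisfy the recursion of [fps_inv f], scaled by [c]. Asking for
    [a * b = c] rather than 1 admits series such as the constant 2, not invertible over the
    integers. *)
Lemma rep_inv (c : int) f a b :
  c != 0 -> rep 1 f a -> a * b = c%:~R -> rep c%:~R (fps_inv f) b.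
Proof.
move=> c0 fa ab.
have fE i : (i <= d)%N -> f i = (tcoef a i)%:~R by move/fa; rewrite mul1r.
have abE i : (i <= d)%N -> \sum_(j < i.+1) f j * (tcoef b (i - j))%:~R =
    if i == 0%N then c%:~R else 0.
  move=> id; rewrite -[c in RHS](mulr1 c) -[RHS](_ : (tcoef (a * b) i)%:~R = _).
    rewrite tcoefM // rmorph_sum; apply: eq_bigr => j _.
    by rewrite rmorphM /= fE // (leq_trans _ id) // -ltnS.
  by rewrite ab -[c%:~R]mulr1 -(expr0 tX) tcoef_monom // mulr1; case: eqP.
have f0 : f 0%N != 0.
  apply: contraNneq c0 => f0; have := abE 0%N isT.
  by rewrite big_ord1 f0 mul0r eqxx -(intr_eq0 rat) => <-.
move=> i; have [n] := ubnP i; elim: n i => // n IHn [|i] in_ id.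
  have := abE 0%N isT; rewrite big_ord1 /= => <-.
  by rewrite /fps_inv /= mulrAC mulfV // mul1r.
have := abE i.+1 id; rewrite big_ord_recl subn0 /= => /eqP.
rewrite addr_eq0 => /eqP fb; rewrite fps_invS.
have -> : (tcoef b i.+1)%:~R = (f 0%N)^-1 * (f 0%N * (tcoef b i.+1)%:~R).
  by rewrite mulKf.
rewrite fb mulrCA mulNr -mulrN; congr (_ * _).
rewrite mulr_sumr; congr (- _); apply: eq_bigr => j _.
rewrite /bump /= add1n subSS mulrCA IHn //.
- by rewrite (leq_ltn_trans (leq_subr _ _)).
- by rewrite (leq_trans (leq_subr _ _)) // ltnW.
Qed.

Lemma rep_qpoch1 a b n : rep 1 (qpoch 1 a b n) (\prod_(j < n) (1 - tX ^+ (a + b * j))).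
Proof.
apply: (rep_prodn (a := fun j => 1 - tX ^+ (a + b * j))) => j.
apply: rep_add; first exact: rep_const1.
have -> : - tX ^+ (a + b * j) = (-1)%:~R * tX ^+ (a + b * j).
  by rewrite mulrN1z mulN1r.
exact: (@rep_mono (-1)).
Qed.

Lemma rep_qpochN1 a b n :
  rep 1 (qpoch (-1) a b n) (\prod_(j < n) (1 + tX ^+ (a + b * j))).
Proof.
apply: (rep_prodn (a := fun j => 1 + tX ^+ (a + b * j))) => j.
apply: rep_add; first exact: rep_const1.
by rewrite -[tX ^+ _]mul1r; apply: (@rep_mono 1); rewrite opprK.
Qed.

Notation gm := (gm tX d.+1).
Notation gp := (gp tX d.+1).
Notation jacobi := (jacobi tX d.+1).
Notation weight := (weight tX d.+1).
Notation theta_quot := (theta_quot tX d.+1).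

Lemma prod_gmK a b n : (0 < a)%N ->
  (\prod_(j < n) (1 - tX ^+ (a + b * j))) * \prod_(j < n) gm (a + b * j) = 1.
Proof.
move=> a0; rewrite -big_split /= big1 // => j _.
by rewrite (gmK tX_nilp) // addn_gt0 a0.
Qed.

Lemma prod_gpK a b n : (0 < a)%N ->
  (\prod_(j < n) (1 + tX ^+ (a + b * j))) * \prod_(j < n) gp (a + b * j) = 1.
Proof.
move=> a0; rewrite -big_split /= big1 // => j _.
by rewrite (gpK tX_nilp) // addn_gt0 a0.
Qed.

Lemma rep_sign n : rep 1 (fps_mono ((-1) ^+ n) n) ((-1) ^+ n * tX ^+ n).
Proof.
have -> : (-1) ^+ n = ((-1) ^+ n)%:~R :> tring by rewrite rmorphXn rmorphN1.
by apply: rep_mono; rewrite rmorphXn rmorphN1.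
Qed.

Lemma rep_p2n n : rep 1 (p2n n) (jacobi n).
Proof.
apply: (rep_sumn (a := fun p => (\prod_(j < p) (1 + tX ^+ j))
  * ((-1) ^+ p * tX ^+ p) * \prod_(j < p) gm j.+1)) => p.
rewrite -[X in rep X]mulr1 -[X in rep (X * _)]mulr1.
apply: rep_mul; first apply: rep_mul.
- have := rep_qpochN1 0 1 p.
  by under eq_bigr => j _ do rewrite add0n mul1n.
- exact: rep_sign.
- apply: (@rep_inv 1) => //; first exact: rep_qpoch1.
  have -> : \prod_(j < p) gm j.+1 = \prod_(j < p) gm (1 + 1 * j).
    by apply: eq_bigr => j _; rewrite mul1n.
  exact: prod_gmK.
Qed.

Lemma rep_summandS n : rep 1 (summand n.+1) (weight n.+1 * jacobi n.+1).
Proof.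
rewrite -[X in rep X]mulr1; apply: rep_mul; last exact: rep_p2n.
rewrite /weight /rho.
set x := \prod_(j < n.+1) _; set y := \prod_(j < n.+1) _.
have -> : x * y * ((-1) ^+ n.+1 * tX ^+ n.+1) * gp (2 * n.+1) =
  x * ((-1) ^+ n.+1 * tX ^+ n.+1) * (y * gp (2 * n.+1)) by ring.
rewrite -[X in rep X]mulr1 -[X in rep (X * _)]mulr1.
apply: rep_mul; first apply: rep_mul.
- exact: rep_qpoch1.
- exact: rep_sign.
apply: (@rep_inv 1) => //.
  rewrite -[X in rep X]mulr1; apply: rep_mul; first exact: rep_qpochN1.
  apply: rep_add; first exact: rep_const1.
  exact: (@rep_mono 1).
by rewrite mulrACA prod_gpK // mul1r mul1r (gpK tX_nilp).
Qed.

Lemma rep_summand0 : rep 2 (summand 0) 1.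
Proof.
have -> : 1 = 1 * 1 * jacobi 0 :> tring.
  by rewrite /jacobi big_ord1 !big_ord0 !expr0 !mulr1.
rewrite -[X in rep X]mulr1; apply: rep_mul; last exact: rep_p2n.
rewrite -[X in rep X]mul1r; apply: rep_mul.
  have := rep_mul (rep_qpoch1 1 2 0) (rep_sign 0).
  by rewrite big_ord0 !expr0 !mulr1.
(* At [n = 0] the denominator 1 + q^0 is 2, whence [c = 2] and [b = 1]. *)
apply: (@rep_inv 2 _ (1 * (1 + 1%:~R * tX ^+ 0))) => //; last by rewrite expr0; ring.
rewrite -[X in rep X]mulr1; apply: rep_mul.
  by have := rep_qpochN1 1 2 0; rewrite big_ord0.
apply: rep_add; first exact: rep_const1.
exact: (@rep_mono 1).
Qed.

Lemma rep_sum_summand n : rep 2 (fps_sumn n.+1 summand)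
  (1 + 2 * \sum_(j < n) weight j.+1 * jacobi j.+1).
Proof.
elim: n => [|n IHn].
  rewrite big_ord0 mulr0 addrC; apply: rep_add; first exact: rep_const0.
  exact: rep_summand0.
rewrite big_ord_recr mulrDr addrA; apply: rep_add => // i id.
(* Later summands are represented at scale 1; doubling the ring element moves them to scale 2. *)
by rewrite !mulr_natl tcoefMn rmorphMn /= -rep_summandS // mul1r.
Qed.

Lemma rep_approx n : (d.+1 < n)%N ->
  rep 2 (approx n) ((1 - tX) *
    (theta_quot d.+1 * (1 + 2 * \sum_(j < d.+1) weight j.+1 * jacobi j.+1))).
Proof.
case: n => // n; rewrite ltnS => dn.
rewrite mulrA -[X in rep X]mul1r; apply: rep_mul; last first.
  rewrite -(big_ord_stable _ (F := fun j => weight j.+1 * jacobi j.+1) dn).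
    exact: rep_sum_summand.
  move=> j dj; rewrite /weight (qpow0 tX_nilp) ?mulr0 ?mul0r //.
  by rewrite (leq_trans dj).
rewrite /theta_quot mulrCA -[X in rep X]mulr1; apply: rep_mul.
  rewrite -(big_ord_stable _ (F := fun j => 1 + tX ^+ (2 * j).+1)
    (leq_trans dn (leqnSn n))).
    exact: rep_qpochN1.
  by move=> j dj; rewrite (qpow0 tX_nilp) ?addr0 //; lia.
apply: (@rep_inv 1) => //; first exact: rep_qpoch1.
(* [theta_quot] starts at 1 - q and the approximant at 1 - q^3. With [n.+2] factors, [1 - tX]
   removes the first and leaves the [n.+1] required. *)
rewrite -(big_ord_stable _ (F := fun j => gm (2 * j).+1)
  (leq_trans dn (leq_trans (leqnSn n) (leqnSn n.+1)))).
  have g1 : (1 - tX) * gm 1 = 1 by rewrite -[X in 1 - X]expr1 (gmK tX_nilp).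
  rewrite [X in (1 - tX) * X]big_ord_recl /= muln0 [(1 - tX) * _]mulrA g1 mul1r.
  rewrite -[RHS](prod_gmK 2 n.+1 (isT : 0 < 3)%N); congr (_ * _).
  apply: eq_bigr => j _; congr gm; rewrite /bump /=; lia.
move=> j dj; have := @gmK _ _ _ tX_nilp (2 * j).+1 isT.
by rewrite (qpow0 tX_nilp) ?subr0 ?mul1r //; lia.
Qed.

Lemma approx_coef i : (i <= d)%N -> exists z : int,
  forall n, (d.+1 < n)%N ->
    approx n i = (if i == 0%N then 1 / 2 else if i == 1%N then - (1 / 2) else 0)
                 + 4 * z%:~R.
Proof.
move=> id; have [x Hx] := theta_quot_sum_cgr8 tX_nilp.
(* The witness does not depend on [n], so the coefficient is stable. Halving the scale-2 identity
   turns modulus 8 into 4. *)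
exists (tcoef ((1 - tX) * x) i) => n /rep_approx /(_ i id); rewrite Hx.
have -> : (1 - tX) * (1 + 8%:R * x) = 1 - tX + ((1 - tX) * x) *+ 8 by ring.
rewrite tcoefD tcoefMn [tcoef (1 - tX) i]tcoefD.
have -> : tcoef 1 i = if i == 0%N then 1 else 0.
  by rewrite /tcoef coef1; case: eqP.
have -> : tcoef (- tX) i = if i == 1%N then -1 else 0.
  have -> : - tX = (-1)%:~R * tX ^+ 1 by rewrite mulrN1z mulN1r.
  exact: tcoef_monom.
rewrite -[tcoef _ _ *+ 8]mulr_natr (intrD _ (_ + _)) intrD intrM.
by case: i {id} => [|[|i]] /= H; lra.
Qed.

End Truncation.

(** * Reading off the Laurent coefficients *)

Theorem theorem1p3 :
  forall k : int,
    exists c : rat,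
      (exists N0 : nat, forall N : nat, (N0 <= N)%N ->
          shift_inv_q (approx N) k = c) /\
      (exists z : int, c - rhs_coeff k = 4 * z%:~R).
Proof.
move=> [n|[|n]].
- have [z Hz] := @approx_coef n.+1 n.+1 (leqnn _).
  (* The factor 1/q makes this the coefficient of q^(n+1), so [d = n.+1] and [d.+1 < N] means
     [n.+3 <= N]. *)
  eexists; split; first by exists n.+3 => N HN; rewrite /= Hz.
  by exists z; rewrite /rhs_coeff /= addrC addrA; case: n {Hz} => [|n] /=; ring.
- have [z Hz] := @approx_coef 0 0 (leqnn _).
  eexists; split; first by exists 2%N => N HN; rewrite /= Hz.
  by exists z; rewrite /rhs_coeff /=; ring.
- by exists 0; split; [exists 0%N | exists 0; rewrite /rhs_coeff /= subr0 mulr0].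
Qed.
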